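(* There exist constants $0<c<C<\infty$ and $\gamma>0$ such that for every integer $n\ge 2$ the uniform sorter on lists of length $n$ satisfies the following, where $\tau_x$ denotes its sorting time started from the list $x$. (Upper bound) For every list $x$ of length $n$, $\mathbb E[\tau_x]\le C n^2\log n$ and $\mathbb P(\tau_x> C n^2\log n)\le C n^{-\gamma}$. (Lower bound) There is a list $x$ of length $n$ with $\mathbb E[\tau_x]\ge c\, n^2\log n$ and $\mathbb P(\tau_x< c\, n^2\log n)\le C n^{-\gamma}$. That is, the uniform sorter requires order $n^2\log n$ comparisons to sort a length-$n$ list in the worst case, both in expectation and with polynomially small failure probability.
   Context: Write $[n]=\{0,1,\dots,n-1\}$. A list of length $n$ is a sequence $x=(x(i))_{i\in[n]}$ with values in a totally ordered set; it is sorted if $x(0)\le x(1)\le\dots\le x(n-1)$. To sort a pair of positions $\{i,j\}$ with $i<j$ means: swap the entries at positions $i$ and $j$ if the entry in position $i$ is larger than the entry in position $j$, and otherwise do nothing. A single step (comparison) of the uniform sorter chooses a pair $\{i,j\}$ of distinct positions uniformly at random from all $\binom n2$ pairs, independently of the past, and sorts that pair. The sorting time $\tau_x$ is the number of steps (comparisons) until the list, started from $x$, is first sorted. $\log$ is the natural logarithm. *)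

(* Defs.v *)
From HB Require Import structures.
From mathcomp Require Import all_boot all_order all_algebra perm.
From mathcomp Require Import all_classical all_reals all_analysis.

Set Implicit Arguments.
Unset Strict Implicit.
Unset Printing Implicit Defensive.

Import Order.TTheory GRing.Theory Num.Theory.

Local Open Scope classical_set_scope.
Local Open Scope ring_scope.

(* An unordered pair {i, j} of distinct positions, encoded by its increasing
   enumeration (i, j) with i < j. *)
Definition pos_pair (n : nat) := {p : 'I_n * 'I_n | (p.1 < p.2)%N}.

Definition sort_pair (n : nat) (d : Order.disp_t) (T : orderType d)
    (p : pos_pair n) (x : n.-tuple T) : n.-tuple T :=
  let: (i, j) := val p in
  if (tnth x j < tnth x i)%O then [tuple tnth x (tperm i j k) | k < n] else x.

Fixpoint run (n : nat) (d : Order.disp_t) (T : orderType d)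
    (s : nat -> pos_pair n) (x : n.-tuple T) (k : nat) : n.-tuple T :=
  if k is k'.+1 then sort_pair (s k') (run s x k') else x.

(* The infimum is +oo when the list never becomes sorted. *)
Definition sorting_time (R : realType) (n : nat) (d : Order.disp_t)
    (T : orderType d) (s : nat -> pos_pair n) (x : n.-tuple T) : \bar R :=
  ereal_inf [set (k%:R : R)%:E | k in [set k : nat | sorted <=%O (run s x k)]].

(* Random variables with values in a finite set F, which carries the discrete
   sigma-algebra: every B : set F is an event. *)
Definition mutually_independent (dO : measure_display)
    (Omega : measurableType dO) (R : realType) (P : probability Omega R)
    (F : finType) (X : nat -> Omega -> F) : Prop :=
  forall (J : seq nat) (B : nat -> set F), uniq J ->
    P (\bigcap_(k in [set` J]) (X k @^-1` B k)) =
    (\prod_(k <- J) P (X k @^-1` B k))%E.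

(* S k is the pair of positions compared at step k + 1. *)
Record uniform_sorter (n : nat) (dO : measure_display)
    (Omega : measurableType dO) (R : realType) (P : probability Omega R)
    (S : nat -> Omega -> pos_pair n) : Prop := UniformSorter {
  steps_measurable : forall (k : nat) (B : set (pos_pair n)),
    measurable (S k @^-1` B);
  steps_uniform : forall (k : nat) (p : pos_pair n),
    P (S k @^-1` [set p]) = (('C(n, 2)%:R : R)^-1)%:E;
  steps_independent : mutually_independent P S }.

Definition tau (R : realType) (n : nat) (Omega : Type) (d : Order.disp_t)
    (T : orderType d) (S : nat -> Omega -> pos_pair n) (x : n.-tuple T)
    (w : Omega) : \bar R :=
  sorting_time R (fun k => S k w) x.

(* Main.v *)
(** Let N = 'C(n, 2).  Sorting an inverted pair lowers the number I of
    inversions by at least 1, and each of the I inverted pairs is chosen with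
    probability 1/N, so E[I] shrinks by the factor 1 - 1/N at every step and the
    list is unsorted after k steps with probability at most N (1 - 1/N)^k.

    For the lower bound start from 1, 0, 3, 2, 5, 4, ...: the only inversions
    that ever occur are the adjacent ones {2i, 2i+1}, and each has to be picked
    (coupon collector).  Sorting one removes exactly one inversion, so
    E[1 / (I + 1)] grows at most by the factor 1 + 1/N per step, and Markov's
    inequality bounds the probability of I = 0 after k steps by
    (1 + 1/N)^k / (n/2 + 1). *)

Require Import Defs.
From HB Require Import structures.
From mathcomp Require Import all_boot all_order all_algebra perm.
From mathcomp Require Import all_classical all_reals all_analysis.
From mathcomp Require Import measurable_realfun.
From mathcomp Require Import zify ring lra.

Set Implicit Arguments.
Unset Strict Implicit.
Unset Printing Implicit Defensive.

Import Order.TTheory GRing.Theory Num.Theory.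

Local Open Scope classical_set_scope.
Local Open Scope ring_scope.

(** * Inversions under one sorting step *)

Definition inversions (n : nat) (d : Order.disp_t) (T : orderType d)
    (x : n.-tuple T) : {set pos_pair n} :=
  [set p : pos_pair n | tnth x (val p).2 < tnth x (val p).1]%O%SET.

Lemma in_inversions (n : nat) (d : Order.disp_t) (T : orderType d)
    (x : n.-tuple T) (p : pos_pair n) :
  (p \in inversions x) = (tnth x (val p).2 < tnth x (val p).1)%O.
Proof. by rewrite inE. Qed.

Lemma card_pos_pair (n : nat) : #|{: pos_pair n}| = 'C(n, 2).
Proof.
rewrite card_sig -sum1_card.
under eq_bigl => p do rewrite inE /=.
rewrite (eq_bigl (fun p : 'I_n * 'I_n => true && (p.1 < p.2)%N)); last by [].
rewrite -(pair_big_dep xpredT (fun i j : 'I_n => (i < j)%N) (fun _ _ => 1%N)) /=.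
(* The larger position j has j smaller partners, and these counts sum to ['C(n, 2)]. *)
rewrite (exchange_big_dep xpredT) //= -bin2_sum big_mkord.
apply: eq_bigr => j _; rewrite sum1_card.
have w_inj : injective (widen_ord (ltnW (ltn_ord j))).
  by move=> a b [ab]; apply: val_inj.
rewrite -[RHS]card_ord -(card_imset _ w_inj).
apply: eq_card => i; rewrite -topredE /=.
apply/idP/imsetP => [ij|[k _ ->]] /=.
  by exists (Ordinal ij) => //; apply: val_inj.
exact: ltn_ord.
Qed.

Lemma tnth_sort_pair (n : nat) (d : Order.disp_t) (T : orderType d)
    (p : pos_pair n) (x : n.-tuple T) (k : 'I_n) :
  tnth (sort_pair p x) k =
  if p \in inversions x then tnth x (tperm (val p).1 (val p).2 k) else tnth x k.
Proof.
rewrite in_inversions /sort_pair; case: (val p) => i j /=.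
by case: ifP => // _; rewrite tnth_mktuple.
Qed.

Lemma sort_pair_id (n : nat) (d : Order.disp_t) (T : orderType d)
    (p : pos_pair n) (x : n.-tuple T) :
  p \notin inversions x -> sort_pair p x = x.
Proof.
by move=> px; apply: eq_from_tnth => k; rewrite tnth_sort_pair (negbTE px).
Qed.

Lemma sorted_inversions (n : nat) (d : Order.disp_t) (T : orderType d)
    (x : n.-tuple T) : sorted <=%O x = (inversions x == finset.set0).
Proof.
case: n x => [|n] x.
  rewrite tuple0 /=; apply/esym/eqP/setP => p.
  by case: (val p).1 => m; rewrite ltn0.
set x0 := tnth x ord0.
apply/idP/eqP => [xs|x_inv].
  apply/setP => p; rewrite in_inversions inE; apply/negbTE; rewrite -leNgt.
  rewrite !(tnth_nth x0); apply: (le_sorted_leq_nth x0 xs);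
    rewrite ?inE ?size_tuple //.
  exact: ltnW (valP p).
rewrite (sorted_pairwise le_trans); apply/(pairwiseP x0) => i j.
rewrite !inE size_tuple => i_n j_n ij.
have := finset.in_set0 (exist _ (Ordinal i_n, Ordinal j_n) ij : pos_pair n.+1).
rewrite -x_inv in_inversions /= !(tnth_nth x0) /=.
by move/negbT; rewrite -leNgt.
Qed.

(* insubd leaves q fixed when the transposed pair is not increasing. *)
Definition pair_flip (n : nat) (p q : pos_pair n) : pos_pair n :=
  let s := tperm (val p).1 (val p).2 in
  insubd q (s (val q).1, s (val q).2).

Lemma pair_flipE (n : nat) (p q : pos_pair n) :
  let s := tperm (val p).1 (val p).2 in
  val (pair_flip p q) =
  if (s (val q).1 < s (val q).2)%N then (s (val q).1, s (val q).2) else val q.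
Proof. by rewrite /pair_flip /= val_insubd. Qed.

Lemma pair_flipK (n : nat) (p : pos_pair n) : involutive (pair_flip p).
Proof.
move=> q; apply: val_inj; rewrite !pair_flipE; set s := tperm _ _.
have [_|/negbTE ge_s] := boolP (s (val q).1 < s (val q).2)%N;
  last by rewrite ge_s.
by rewrite /= !tpermK (valP q) -surjective_pairing.
Qed.

Lemma pair_flip_id (n : nat) (p : pos_pair n) : pair_flip p p = p.
Proof.
apply: val_inj; rewrite pair_flipE tpermL tpermR ifF //.
by apply/negbTE; rewrite -leqNgt; apply: ltnW (valP p).
Qed.

(** Sorting [p] permutes the entries by a transposition s, so if s keeps the order of [q], the
    flipped pair is inverted in [x]. If s reverses it and [q] is not [p], then [q] joins a position
    of [p] to one lying between those of [p], and transitivity with the inversion [p] shows that [q]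
    itself is inverted in [x]. *)
Lemma pair_flip_inversions (n : nat) (d : Order.disp_t) (T : orderType d)
    (p q : pos_pair n) (x : n.-tuple T) : p \in inversions x ->
  q \in inversions (sort_pair p x) -> pair_flip p q \in inversions x :\ p.
Proof.
move=> px; rewrite !inE !tnth_sort_pair px => q_inv.
have q_neq_p : pair_flip p q != p.
  apply: contraTneq q_inv => qp; rewrite -[q](pair_flipK p) qp pair_flip_id.
  by rewrite tpermL tpermR -leNgt; move: px; rewrite in_inversions => /ltW.
rewrite q_neq_p pair_flipE; case: ifP => // /negbT.
rewrite -leqNgt; move: px q_inv (valP q) (valP p); rewrite in_inversions.
case: (val p) (val q) => i j [a b] /=.
by case: (tpermP i j a) => [->|->|/eqP ai /eqP aj];
  case: (tpermP i j b) => [->|->|/eqP bi /eqP bj];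
  rewrite ?ltnn // => x1 x2 l1 l2 l3;
  first [by move: (lt_trans x1 x2); rewrite ?ltxx
        | by apply: lt_trans x1 | by apply: lt_trans x2
        | by move: l1; rewrite ltnNge ?l3
        | lia].
Qed.

(** The involution [pair_flip p] injects the inversions left after sorting an inverted [p] into
    those of [x] other than [p]. *)
Lemma card_inversions_sort_pair (n : nat) (d : Order.disp_t) (T : orderType d)
    (p : pos_pair n) (x : n.-tuple T) :
  (#|inversions (sort_pair p x)| + (p \in inversions x) <= #|inversions x|)%N.
Proof.
have [px|px] := boolP (p \in _); last by rewrite sort_pair_id // addn0.
rewrite (finset.cardsD1 p (inversions x)) px addnC leq_add2l.
rewrite -(card_imset (inversions (sort_pair p x)) (inv_inj (pair_flipK p))).
apply/subset_leq_card/fintype.subsetP => _ /imsetP[q q_inv ->].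
exact: pair_flip_inversions.
Qed.

(** * The list of swapped neighbours *)

Definition block_swap (n : nat) : n.-tuple nat :=
  [tuple (i./2.*2 + ~~ odd i)%N | i < n].

(** Invariant of the runs from [block_swap]: no entry leaves its block {2i, 2i+1}. *)
Definition in_blocks (n : nat) (x : n.-tuple nat) :=
  forall i : 'I_n, (tnth x i)./2 = i./2.

Lemma in_blocks_block_swap (n : nat) : in_blocks (block_swap n).
Proof. by move=> i; rewrite tnth_mktuple; case: (odd i); lia. Qed.

(** Values in an earlier block are smaller than those in a later one, so an inverted pair lies
    inside a single block. *)
Lemma in_blocks_inversion (n : nat) (p : pos_pair n) (x : n.-tuple nat) :
  in_blocks x -> p \in inversions x ->
  ~~ odd (val p).1 /\ nat_of_ord (val p).2 = (val p).1.+1.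
Proof.
move=> xb; rewrite in_inversions ltEnat /=.
have := xb (val p).1; have := xb (val p).2; have /= := valP p.
by move: (tnth x _) (tnth x _) => u v; lia.
Qed.

Lemma in_blocks_sort_pair (n : nat) (p : pos_pair n) (x : n.-tuple nat) :
  in_blocks x -> in_blocks (sort_pair p x).
Proof.
move=> xb i; rewrite tnth_sort_pair; case: ifP => [px|_]; last exact: xb.
have [p1 p2] := in_blocks_inversion xb px.
by rewrite xb; case: tpermP => // ->; lia.
Qed.

(** Distinct inverted pairs lie in distinct blocks, so sorting one leaves the entries of the others
    in place. *)
Lemma inversions_sort_pair_in_blocks (n : nat) (p : pos_pair n)
    (x : n.-tuple nat) :
  in_blocks x -> inversions x :\ p \subset inversions (sort_pair p x).
Proof.
move=> xb; apply/fintype.subsetP => q; rewrite 2!inE => /andP[qp qx].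
have [px|px] := boolP (p \in inversions x); last by rewrite sort_pair_id.
have [p1 p2] := in_blocks_inversion xb px.
have [q1 q2] := in_blocks_inversion xb qx.
have qp1 : (val q).1 <> (val p).1 :> nat.
  move=> e; case/eqP: qp; apply: val_inj.
  rewrite [LHS]surjective_pairing [RHS]surjective_pairing.
  by congr pair; apply: val_inj => //=; rewrite q2 p2 e.
rewrite in_inversions !tnth_sort_pair px !tpermD -?in_inversions //;
  apply/negP => /eqP/(congr1 (@nat_of_ord n)); move: p1 p2 q1 q2 qp1;
  by case: (val p) (val q) => [[i ?] [j ?]] [[a ?] [b ?]] /=; lia.
Qed.

Lemma card_inversions_block_swap (n : nat) :
  (n./2 <= #|inversions (block_swap n)|)%N.
Proof.
have lt1 (k : 'I_n./2) : (k.*2 < n)%N by have := ltn_ord k; lia.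
have lt2 (k : 'I_n./2) : (k.*2.+1 < n)%N by have := ltn_ord k; lia.
pose f (k : 'I_n./2) : pos_pair n :=
  exist _ (Ordinal (lt1 k), Ordinal (lt2 k)) (ltnSn k.*2).
have f_inj : injective f.
  move=> k l /(congr1 (fun p => nat_of_ord (val p).1)) /= kl.
  by apply: ord_inj; lia.
rewrite -[leqLHS]card_ord -(card_imset _ f_inj).
apply/subset_leq_card/fintype.subsetP => _ /imsetP[k _ ->].
by rewrite in_inversions !tnth_mktuple ltEnat /=; lia.
Qed.

(** * Averaging operator and law of the run *)

Definition sort_mean (R : realType) (n : nat) (d : Order.disp_t)
    (T : orderType d) (f : n.-tuple T -> R) (x : n.-tuple T) : R :=
  'C(n, 2)%:R^-1 * \sum_(p : pos_pair n) f (sort_pair p x).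

(** [sort_mean] is the transition operator of the chain; being monotone, it lets the drift of [f] on
    the invariant set [J] be iterated. With [h] the indicator of an event, this contains Markov's
    inequality. *)
Lemma iter_sort_mean_le (R : realType) (n : nat) (d : Order.disp_t)
    (T : orderType d) (J : n.-tuple T -> Prop) (h f : n.-tuple T -> R)
    (lam : R) (k : nat) (x : n.-tuple T) :
  0 <= lam ->
  (forall p y, J y -> J (sort_pair p y)) ->
  (forall y, J y -> sort_mean f y <= lam * f y) ->
  (forall y, J y -> h y <= f y) ->
  J x -> iter k (@sort_mean R n d T) h x <= lam ^+ k * f x.
Proof.
move=> lam0 J_sort f_le hf; elim: k x => [|k IH] x Jx.
  by rewrite expr0 mul1r; exact: hf.
rewrite iterS exprSr -mulrA.
apply: le_trans (ler_wpM2l (exprn_ge0 k lam0) (f_le _ Jx)).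
rewrite /sort_mean mulrCA ler_wpM2l ?invr_ge0 ?ler0n // mulr_sumr.
by apply: ler_sum => p _; apply/IH/J_sort.
Qed.

(** Linearity of the operator, used to append one random step in the law of the run. *)
Lemma iter_sort_mean_sum (R : realType) (n : nat) (d : Order.disp_t)
    (T : orderType d) (g : pos_pair n -> n.-tuple T -> R) (k : nat)
    (x : n.-tuple T) :
  iter k (@sort_mean R n d T)
    (fun y => 'C(n, 2)%:R^-1 * \sum_p g p y) x =
  'C(n, 2)%:R^-1 * \sum_p iter k (@sort_mean R n d T) (g p) x.
Proof.
elim: k x => [//|k IH] x; rewrite iterS /sort_mean; congr (_ * _).
under eq_bigr => p _ do rewrite IH.
by rewrite -mulr_sumr exchange_big mulr_sumr.
Qed.

Lemma sort_mean_card_inversions (R : realType) (n : nat) (d : Order.disp_t)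
    (T : orderType d) (x : n.-tuple T) : (2 <= n)%N ->
  sort_mean (fun y => #|inversions y|%:R : R) x <=
  (1 - 'C(n, 2)%:R^-1) * #|inversions x|%:R.
Proof.
move=> n2; have N0 : 0 < 'C(n, 2)%:R :> R by rewrite ltr0n bin_gt0.
rewrite /sort_mean ler_pdivrMl // mulrA mulrBr mulr1 divff ?gt_eqF // mulrBl.
rewrite mul1r lerBrDr -natr_sum -natrD -natrM ler_nat.
rewrite -card_pos_pair -sum_nat_const -[X in (_ + X)%N]sum1_card.
rewrite [X in (_ + X)%N]big_mkcond -big_split /=.
by apply: leq_sum => p _; have := card_inversions_sort_pair p x;
  case: (p \in _).
Qed.

(** The last chosen pair takes finitely many values, and each value is absorbed into the predicate
    [B], over which the induction is general. *)
Lemma run_measurable (R : realType) (n : nat) (d : Order.disp_t)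
    (T : orderType d) (dO : measure_display) (Omega : measurableType dO)
    (P : probability Omega R) (S : nat -> Omega -> pos_pair n)
    (x : n.-tuple T) (k : nat) (B : n.-tuple T -> bool) :
  uniform_sorter P S -> measurable [set w | B (run (fun i => S i w) x k)].
Proof.
move=> US; elim: k B => [|k IH] B /=.
  by case: (B x); rewrite ?set_true ?set_false.
rewrite [X in measurable X](_ : _ = \bigcup_(p in [set: pos_pair n])
    (S k @^-1` [set p] `&` [set w | B (sort_pair p (run (fun i => S i w) x k))])).
  apply: fin_bigcup_measurable => [|p _]; first exact: finite_finset.
  apply: measurableI.
    exact: (steps_measurable US).
  exact: (IH (fun y => B (sort_pair p y))).
apply/seteqP; split=> [w /= Bw|w [p _ [/= <- //]]].
by exists (S k w).
Qed.

(* Prescribing the j steps after time k is what lets the induction on k peel off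
   the last step of the run. *)
Lemma run_prob_steps (R : realType) (n : nat) (d : Order.disp_t)
    (T : orderType d) (dO : measure_display) (Omega : measurableType dO)
    (P : probability Omega R) (S : nat -> Omega -> pos_pair n)
    (x : n.-tuple T) (k j : nat) (q : nat -> pos_pair n)
    (B : n.-tuple T -> bool) :
  uniform_sorter P S ->
  P ([set w | B (run (fun i => S i w) x k)] `&`
     \bigcap_(i in [set` iota k j]) (S i @^-1` [set q i])) =
  (iter k (@sort_mean R n d T) (fun y => (B y)%:R) x * 'C(n, 2)%:R^-1 ^+ j)%:E.
Proof.
move=> US; elim: k j q B => [|k IH] j q B.
  (* At time 0 the list is deterministic, and independence gives one factor ['C(n, 2)%:R^-1] per
     prescribed step. *)
  rewrite /=; case: (B x); last by rewrite set_false set0I measure0 mul0r.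
  rewrite set_true setTI mul1r (steps_independent US) ?iota_uniq //.
  under eq_bigr => i _ do rewrite (steps_uniform US).
  by rewrite prodEFin big_const_seq count_predT size_iota iter_mulr_1.
(* The event is split by the value p of step [k], which joins the prescribed steps and also enters
   the predicate. *)
pose qp p i := if i == k then p else q i.
rewrite [X in P X](_ : _ = \bigcup_(p in [set: pos_pair n])
    ([set w | B (sort_pair p (run (fun i => S i w) x k))] `&`
     \bigcap_(i in [set` iota k j.+1]) (S i @^-1` [set qp p i]))); last first.
  apply/seteqP; split=> w.
    move=> [Bw Sq]; exists (S k w) => //; split=> [//|i].
    rewrite /= in_cons /qp.
    by case: eqVneq => [->|_] //= ik; apply: Sq.
  move=> [p _ [Bw Sqp]].
  have Sk : S k w = p by have := Sqp k (mem_head _ _); rewrite /= /qp eqxx.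
  subst p; split=> [|i ik]; first exact: Bw.
  have := Sqp i; rewrite /= in_cons /qp ik orbT => /(_ isT).
  by rewrite ifN_eq //; apply: contraTneq ik => ->; rewrite mem_iota ltnn.
rewrite measure_fin_bigcup; last 3 first.
- exact: finite_finset.
- move=> p p' _ _ [w [[_ /(_ k (mem_head _ _)) Sp] [_ /(_ k (mem_head _ _))]]].
  by move: Sp; rewrite /= /qp eqxx => -> ->.
- move=> p _; apply: measurableI.
    exact: (run_measurable x k (fun y => B (sort_pair p y)) US).
  by apply: fin_bigcap_measurable => // i _; exact: (steps_measurable US).
rewrite (fsbigE (index_enum (pos_pair n))) ?index_enum_uniq //=; last first.
  by move=> p _; rewrite mem_index_enum.
under eq_bigl => p do rewrite in_setT.
under eq_bigr => p _ do rewrite (IH j.+1 (qp p) (fun y => B (sort_pair p y))).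
rewrite sumEFin -mulr_suml; congr EFin.
(* One factor of the power becomes the weight in the average over step [k]. *)
rewrite exprS mulrA; congr (_ * _); rewrite mulrC -iter_sort_mean_sum.
by rewrite -[RHS]/(iter k.+1 (@sort_mean R n d T) _ x) iterSr.
Qed.

Lemma run_prob (R : realType) (n : nat) (d : Order.disp_t)
    (T : orderType d) (dO : measure_display) (Omega : measurableType dO)
    (P : probability Omega R) (S : nat -> Omega -> pos_pair n)
    (x : n.-tuple T) (k : nat) (B : n.-tuple T -> bool) :
  (2 <= n)%N -> uniform_sorter P S ->
  P [set w | B (run (fun i => S i w) x k)] =
  (iter k (@sort_mean R n d T) (fun y => (B y)%:R) x)%:E.
Proof.
(* No step gets prescribed; the pair (0, 1) only supplies some sequence [q]. *)
move=> n2 US; pose p : pos_pair n :=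
  exist _ (Ordinal (ltnW n2), Ordinal n2) (ltn0Sn 0).
have := run_prob_steps x k 0 (fun=> p) B US.
by rewrite set_nil bigcap_set0 setIT mulr1.
Qed.

Lemma run_prob_unsorted (R : realType) (n : nat) (d : Order.disp_t)
    (T : orderType d) (dO : measure_display) (Omega : measurableType dO)
    (P : probability Omega R) (S : nat -> Omega -> pos_pair n)
    (x : n.-tuple T) (k : nat) :
  (2 <= n)%N -> uniform_sorter P S ->
  (P [set w | ~~ sorted <=%O (run (fun i => S i w) x k)] <=
   ((1 - 'C(n, 2)%:R^-1) ^+ k * 'C(n, 2)%:R)%:E)%E.
Proof.
move=> n2 US; rewrite (run_prob x k (fun y => ~~ sorted <=%O y)) // lee_fin.
have N1 : 1 <= 'C(n, 2)%:R :> R by rewrite ler1n bin_gt0.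
have q0 : 0 <= 1 - 'C(n, 2)%:R^-1 :> R.
  by rewrite subr_ge0 invf_le1 // (lt_le_trans ltr01).
(* An integer vanishing only on sorted lists, so it dominates the indicator of unsortedness. *)
pose f (y : n.-tuple T) : R := #|inversions y|%:R.
apply: (@le_trans _ _ ((1 - 'C(n, 2)%:R^-1) ^+ k * f x)).
  apply: (@iter_sort_mean_le _ _ _ _ (fun=> True)) => // y _.
    exact: sort_mean_card_inversions.
  by rewrite sorted_inversions -cards_eq0 /f; case: #|_| => //= m; rewrite ler1n.
rewrite ler_wpM2l ?exprn_ge0 // ler_nat -card_pos_pair; exact: max_card.
Qed.

Lemma sort_mean_inv_card_inversions (R : realType) (n : nat) (x : n.-tuple nat) :
  (2 <= n)%N -> in_blocks x ->
  sort_mean (fun y => (#|inversions y|.+1%:R : R)^-1) x <=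
  (1 + 'C(n, 2)%:R^-1) * #|inversions x|.+1%:R^-1.
Proof.
move=> n2 xb; have N0 : 0 < 'C(n, 2)%:R :> R by rewrite ltr0n bin_gt0.
rewrite /sort_mean ler_pdivrMl // mulrA mulrDr mulr1 divff ?gt_eqF // mulrDl.
set u := #|inversions x|; set f : R := _.+1%:R^-1.
have f0 : 0 <= f by rewrite invr_ge0.
(* Here f = 1/(u+1). Sorting one of the u inversions leaves at least u - 1, for a value of at most
   1/u = f + f/u. *)
apply: (@le_trans _ _ (\sum_(p : pos_pair n)
    (f + (if p \in inversions x then u%:R^-1 * f else 0)))).
  apply: ler_sum => p _; case: ifP => px; last first.
    by rewrite sort_pair_id ?px // addr0.
  have u_eq := finset.cardsD1 p (inversions x).
  have u_le := subset_leq_card (inversions_sort_pair_in_blocks p xb).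
  rewrite px -/u add1n in u_eq; rewrite /f u_eq.
  set v := #|_ :\ p| in u_eq u_le *.
  rewrite [leRHS](_ : _ = v.+1%:R^-1); last first.
    have v0 : 0 <= v%:R :> R by [].
    by rewrite -!natr1; field; apply/andP; split; apply: lt0r_neq0; lra.
  by rewrite lef_pV2 ?posrE ?ltr0n // ler_nat.
rewrite big_split /= sumr_const card_pos_pair -[f *+ _]mulr_natl lerD2l.
rewrite -big_mkcond /=.
(* The u surplus terms f/u add up to f; for [u = 0] they vanish. *)
rewrite sumr_const -[(_ * f) *+ _]mulr_natl mulrA -/u mul1r; have [->|u0] := posnP u.
  by rewrite !mul0r.
by rewrite divff ?mul1r // pnatr_eq0 -lt0n.
Qed.

Lemma run_prob_sorted_block_swap (R : realType) (n : nat)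
    (dO : measure_display) (Omega : measurableType dO)
    (P : probability Omega R) (S : nat -> Omega -> pos_pair n) (k : nat) :
  (2 <= n)%N -> uniform_sorter P S ->
  (P [set w | sorted <=%O (run (fun i => S i w) (block_swap n) k)] <=
   ((1 + 'C(n, 2)%:R^-1) ^+ k * (n./2.+1)%:R^-1)%:E)%E.
Proof.
move=> n2 US; rewrite (run_prob _ k (fun y => sorted <=%O y)) // lee_fin.
(* Equal to 1 on sorted lists and nonnegative elsewhere, so it dominates the indicator of
   sortedness. *)
pose f (y : n.-tuple nat) : R := #|inversions y|.+1%:R^-1.
apply: (@le_trans _ _ ((1 + 'C(n, 2)%:R^-1) ^+ k * f (block_swap n))).
  apply: (@iter_sort_mean_le _ _ _ _ (@in_blocks n)).
  - by rewrite addr_ge0 ?invr_ge0.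
  - by move=> p y; exact: in_blocks_sort_pair.
  - by move=> y; exact: sort_mean_inv_card_inversions.
  - move=> y yb; rewrite sorted_inversions -cards_eq0 /f; case: eqP => [->|_].
      by rewrite invr1.
    by rewrite invr_ge0.
  - exact: in_blocks_block_swap.
rewrite ler_wpM2l ?exprn_ge0 ?addr_ge0 ?invr_ge0 //.
by rewrite lef_pV2 ?posrE ?ltr0n // ler_nat ltnS card_inversions_block_swap.
Qed.

(** * Sorting time as a sum of indicators *)

Lemma run_sorted (n : nat) (d : Order.disp_t) (T : orderType d)
    (s : nat -> pos_pair n) (x : n.-tuple T) (k l : nat) :
  (k <= l)%N -> sorted <=%O (run s x k) -> sorted <=%O (run s x l).
Proof.
move=> /subnK <-; elim: (l - k)%N => // m IH xs; have := IH xs.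
rewrite addSn /= {1}sorted_inversions => /eqP x0.
by rewrite sort_pair_id ?IH // x0 finset.in_set0.
Qed.

(** Sorted lists stay sorted, so the indicators are 1 exactly before the sorting time. This reduces
    its mean to probabilities at fixed times. *)
Lemma sorting_time_series (R : realType) (n : nat) (d : Order.disp_t)
    (T : orderType d) (s : nat -> pos_pair n) (x : n.-tuple T) :
  sorting_time R s x =
  (\sum_(0 <= k <oo) ((~~ sorted <=%O (run s x k))%:R : R)%:E)%E.
Proof.
have t0 k : (0 <= k)%N -> (0 <= ((~~ sorted <=%O (run s x k))%:R : R)%:E)%E.
  by rewrite lee_fin.
have [[k xk]|unsorted] := pselect (exists k, sorted <=%O (run s x k)).
  have exk : exists k, sorted <=%O (run s x k) by exists k.
  case: (ex_minnP exk) => m xm m_min {k xk exk}.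
  rewrite (nneseries_split 0 m t0) add0n [X in (_ + X)%E]eseries0; last first.
    by move=> i mi _; rewrite (run_sorted mi xm).
  rewrite adde0 (eq_big_nat _ _ (F2 := fun=> 1%:E)); last first.
    move=> i /andP[_ im]; case: (boolP (sorted _ _)) => // /m_min.
    by rewrite leqNgt im.
  rewrite sumEFin sumr_const_nat subn0.
  apply/eqP; rewrite eq_le; apply/andP; split.
    by apply: ereal_inf_lbound; exists m.
  by apply: le_ereal_inf_tmp => _ [k xk <-]; rewrite lee_fin ler_nat m_min.
(* If the list is never sorted, both sides are infinite. *)
rewrite /sorting_time (_ : [set k | sorted <=%O (run s x k)] = set0).
  rewrite image_set0.
  rewrite ereal_inf0; apply/esym/eqyP => A A0.
  have [M AM] : exists M : nat, A <= M%:R.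
    by exists (Num.bound A); exact: ltW (archi_boundP (ltW A0)).
  apply: le_trans (nneseries_lim_ge M _); last by move=> k _ _; exact: t0.
  rewrite (eq_big_nat _ _ (F2 := fun=> 1%:E)); last first.
    by move=> i _; case: (boolP (sorted _ _)) => // xi; case: unsorted; exists i.
  by rewrite sumEFin sumr_const_nat subn0 lee_fin.
by apply/seteqP; split=> // k xk; apply: unsorted; exists k.
Qed.

Definition unsorted_at (n : nat) (Omega : Type) (d : Order.disp_t)
    (T : orderType d) (S : nat -> Omega -> pos_pair n) (x : n.-tuple T)
    (k : nat) : set Omega :=
  [set w | ~~ sorted <=%O (run (fun i => S i w) x k)].

Lemma tau_series (R : realType) (n : nat) (d : Order.disp_t) (Omega : Type)
    (T : orderType d) (S : nat -> Omega -> pos_pair n) (x : n.-tuple T) :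
  tau R S x =
  (fun w => \sum_(0 <= k <oo) (\1_(unsorted_at S x k) w : R)%:E)%E.
Proof.
apply/funext => w; rewrite /tau sorting_time_series; apply: eq_eseriesr => k _.
by rewrite indicE; congr ((nat_of_bool _)%:R%:E); apply/idP/idP; rewrite inE.
Qed.

Lemma measurable_tau (R : realType) (n : nat) (d : Order.disp_t)
    (T : orderType d) (dO : measure_display) (Omega : measurableType dO)
    (P : probability Omega R) (S : nat -> Omega -> pos_pair n)
    (x : n.-tuple T) :
  uniform_sorter P S -> measurable_fun [set: Omega] (tau R S x).
Proof.
move=> US; rewrite tau_series.
apply: ge0_emeasurable_sum => [k w _ _|k _]; first by rewrite lee_fin.
apply/measurable_EFinP/measurable_indic.
exact: (run_measurable x k (fun y => ~~ sorted <=%O y) US).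
Qed.

Lemma integral_tau (R : realType) (n : nat) (d : Order.disp_t)
    (T : orderType d) (dO : measure_display) (Omega : measurableType dO)
    (P : probability Omega R) (S : nat -> Omega -> pos_pair n)
    (x : n.-tuple T) :
  uniform_sorter P S ->
  (\int[P]_w tau R S x w = \sum_(0 <= k <oo) P (unsorted_at S x k))%E.
Proof.
move=> US; rewrite tau_series.
have mA k : measurable (unsorted_at S x k).
  exact: (run_measurable x k (fun y => ~~ sorted <=%O y) US).
rewrite integral_nneseries //; last first.
  by move=> k; apply/measurable_EFinP/measurable_indic.
by apply: eq_eseriesr => k _; rewrite integral_indic // setIT.
Qed.

Lemma prob_tau_gt_le (R : realType) (n : nat) (d : Order.disp_t)
    (T : orderType d) (dO : measure_display) (Omega : measurableType dO)
    (P : probability Omega R) (S : nat -> Omega -> pos_pair n)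
    (x : n.-tuple T) (k : nat) (t : R) :
  uniform_sorter P S -> k%:R <= t ->
  (P [set w | (t%:E < tau R S x w)%E] <= P (unsorted_at S x k))%E.
Proof.
move=> US kt; apply: le_measure; rewrite ?inE.
- rewrite -[X in measurable X]setTI; apply: emeasurable_fun_o_infty => //.
  exact: measurable_tau US.
- exact: (run_measurable x k (fun y => ~~ sorted <=%O y) US).
move=> w /=; apply: contraTN => xs; rewrite -leNgt.
apply: (@le_trans _ _ k%:R%:E); last by rewrite lee_fin.
by apply: ereal_inf_lbound; exists k.
Qed.

(** A sorting time below [t] is an integer below k + 1, so the list is sorted by time k and remains
    so. *)
Lemma prob_tau_lt_le (R : realType) (n : nat) (d : Order.disp_t)
    (T : orderType d) (dO : measure_display) (Omega : measurableType dO)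
    (P : probability Omega R) (S : nat -> Omega -> pos_pair n)
    (x : n.-tuple T) (k : nat) (t : R) :
  uniform_sorter P S -> t <= k.+1%:R ->
  (P [set w | (tau R S x w < t%:E)%E] <=
   P [set w | sorted <=%O (run (fun i => S i w) x k)])%E.
Proof.
move=> US tk; apply: le_measure; rewrite ?inE.
- rewrite -[X in measurable X]setTI; apply: emeasurable_fun_infty_o => //.
  exact: measurable_tau US.
- exact: (run_measurable x k (fun y => sorted <=%O y) US).
move=> w /= /ereal_inf_lt[_ [j xj <-]]; rewrite lte_fin => jt.
by apply: run_sorted xj; rewrite -ltnS -(ltr_nat R); apply: lt_le_trans tk.
Qed.

(** * Numerical estimates *)

Lemma bin2_bounds (R : realType) (n : nat) : (2 <= n)%N ->
  [/\ 1 <= 'C(n, 2)%:R :> R, 2 * 'C(n, 2)%:R <= n%:R ^+ 2 :> R &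
      n%:R ^+ 2 <= 4 * 'C(n, 2)%:R :> R].
Proof.
move=> n2; have N1 : (0 < 'C(n, 2))%N by rewrite bin_gt0.
have := mul_bin_left n 1; rewrite bin1 => bin_n.
rewrite -!natrX -!natrM ler1n !ler_nat; split=> //; nia.
Qed.

(** The inequality exp(y) >= 1 + y at y = - ln n gives ln n >= 1 - 1/n. *)
Lemma half_le_ln (R : realType) (n : nat) : (2 <= n)%N -> 2^-1 <= ln n%:R :> R.
Proof.
move=> n2; have n0 : 0 < n%:R :> R by rewrite ltr0n ltnW.
have := expR_ge1Dx (- ln n%:R : R); rewrite expRN lnK ?posrE //.
have : n%:R^-1 <= 2^-1 :> R by rewrite lef_pV2 ?posrE // ler_nat.
lra.
Qed.

Lemma powR_quarter (R : realType) (n : nat) : (0 < n)%N ->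
  n%:R `^ (- 4^-1) = expR (- (ln n%:R / 4)) :> R.
Proof. by move=> n0; rewrite /powR pnatr_eq0 gtn_eqF // mulNr mulrC. Qed.

Lemma expr_1D_le (R : realType) (y : R) (k : nat) :
  0 <= 1 + y -> (1 + y) ^+ k <= expR (k%:R * y).
Proof.
by move=> y0; rewrite expRM_natl lerXn2r ?nnegrE ?expR_ge0 ?expR_ge1Dx.
Qed.

(** The terms are the bounds on the probability of being unsorted at time k: the trivial one before
    [K], the decay of inversions from then on. *)
Lemma truncated_geometric_sum (R : realType) (N : R) (K m : nat) : 1 <= N ->
  \sum_(0 <= k < m) (if (k < K)%N then 1 else (1 - N^-1) ^+ k * N) <=
  K%:R + N ^+ 2 * (1 - N^-1) ^+ K.
Proof.
move=> N1; have N0 : 0 < N by apply: lt_le_trans N1.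
set q : R := 1 - N^-1.
have q0 : 0 <= q by rewrite subr_ge0 invf_le1.
(* Exact partial sums; the minimum and maximum cover both [m <= K] and [m > K]. *)
have -> : \sum_(0 <= k < m) (if (k < K)%N then 1 else q ^+ k * N) =
    (minn m K)%:R + N ^+ 2 * (q ^+ K - q ^+ maxn m K).
  elim: m => [|m IH]; first by rewrite big_geq // min0n max0n subrr mulr0 addr0.
  rewrite big_nat_recr //= IH; case: ltnP => [mK|Km].
    by rewrite (minn_idPl mK) (maxn_idPr mK) -natr1; ring.
  rewrite (minn_idPr (leqW Km)) (maxn_idPl (leqW Km)) [q ^+ m.+1]exprS.
  move: (q ^+ K) (q ^+ m) => a b; rewrite /q.
  by field; rewrite gt_eqF.
apply: lerD; first by rewrite ler_nat geq_minr.
by rewrite ler_wpM2l ?sqr_ge0 // gerBl exprn_ge0.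
Qed.

Lemma tail_bound (R : realType) (n k : nat) : (2 <= n)%N ->
  3 * n%:R ^+ 2 * ln n%:R <= k.+1%:R :> R ->
  (1 - 'C(n, 2)%:R^-1) ^+ k * 'C(n, 2)%:R <= 3 * n%:R `^ (- 4^-1) :> R.
Proof.
move=> n2 kT; have [N1 N2 _] := bin2_bounds R n2; have L2 := half_le_ln R n2.
have n0 : 0 < n%:R :> R by rewrite ltr0n ltnW.
rewrite powR_quarter; last exact: ltnW.
set N : R := 'C(n, 2)%:R in N1 N2 *; set L : R := ln n%:R in L2 kT *.
have N0 : 0 < N by apply: lt_le_trans N1.
have q0 : 0 <= 1 - N^-1 by rewrite subr_ge0 invf_le1.
(* As n^2 >= 2N, k + 1 >= 6NL; the 1 lost by rounding costs at most 1 after division by N >= 1. *)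
have kN : 6 * L - 1 <= k%:R / N.
  by rewrite ler_pdivlMr //; move: kT; rewrite -natr1 => kT; nra.
apply: (@le_trans _ _ (expR (1 - 6 * L) * expR (2 * L))).
  apply: ler_pM; rewrite ?exprn_ge0 ?(ltW N0) //.
    apply: le_trans (expr_1D_le _ q0) _; rewrite ler_expR; lra.
  by rewrite expRM_natl lnK ?posrE //; lra.
(* 1 - 4L <= - L/4 because L >= 1/2; the factor 3 is slack. *)
rewrite -expRD; apply: (@le_trans _ _ (expR (- (L / 4)))).
  by rewrite ler_expR; lra.
by rewrite ler_peMl ?expR_ge0 // ler1n.
Qed.

Lemma mean_bound (R : realType) (n : nat) : (2 <= n)%N ->
  exists K : nat, K%:R + 'C(n, 2)%:R ^+ 2 * (1 - 'C(n, 2)%:R^-1) ^+ K <=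
    3 * n%:R ^+ 2 * ln n%:R :> R.
Proof.
move=> n2; have [N1 N2 _] := bin2_bounds R n2; have L2 := half_le_ln R n2.
have n0 : 0 < n%:R :> R by rewrite ltr0n ltnW.
have n4 : 4 <= n%:R ^+ 2 :> R by rewrite -natrX ler_nat; nia.
set N : R := 'C(n, 2)%:R in N1 N2 *; set L : R := ln n%:R in L2 *.
have N0 : 0 < N by apply: lt_le_trans N1.
have q0 : 0 <= 1 - N^-1 by rewrite subr_ge0 invf_le1.
have T0 : 0 <= 2 * n%:R ^+ 2 * L by nra.
have /andP[KT TK] := truncn_itv T0.
(* From this time on the geometric tail is at most N^2 / n^4 <= 1/4, and n^2 L >= 2 absorbs both
   this and the rounding up. *)
exists (Num.truncn (2 * n%:R ^+ 2 * L)).+1; set K := (Num.truncn _).+1 in TK *.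
have qK : (1 - N^-1) ^+ K <= expR (- (4 * L)).
  apply: le_trans (expr_1D_le _ q0) _; rewrite ler_expR mulrN lerN2.
  by rewrite ler_pdivlMr //; nra.
have e4 : expR (4 * L) = (n%:R ^+ 2) ^+ 2.
  by rewrite expRM_natl lnK ?posrE // -exprM.
have : N ^+ 2 * (1 - N^-1) ^+ K <= 4^-1.
  apply: le_trans (ler_wpM2l (sqr_ge0 N) qK) _.
  by rewrite expRN e4 ler_pdivrMr ?exprn_gt0 //; nra.
by move: KT; rewrite /K -natr1; nra.
Qed.

Lemma block_swap_bound (R : realType) (n k : nat) : (2 <= n)%N ->
  k%:R <= n%:R ^+ 2 * ln n%:R / 16 :> R ->
  (1 + 'C(n, 2)%:R^-1) ^+ k * n./2.+1%:R^-1 <= n%:R `^ (- 4^-1) :> R.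
Proof.
move=> n2 kT; have [N1 _ N4] := bin2_bounds R n2; have L2 := half_le_ln R n2.
have n0 : 0 < n%:R :> R by rewrite ltr0n ltnW.
rewrite powR_quarter; last exact: ltnW.
set N : R := 'C(n, 2)%:R in N1 N4 *; set L : R := ln n%:R in L2 kT *.
have N0 : 0 < N by apply: lt_le_trans N1.
(* n <= (n/2 + 1)^2, with n/2 rounded down. *)
have m_ge : expR (L / 2) <= n./2.+1%:R.
  rewrite -(@ler_pXn2r _ 2) ?nnegrE ?expR_ge0 // -expRM_natl mulrC divfK //.
  by rewrite lnK ?posrE // -natrX ler_nat; nia.
(* Growth by at most exp(L/4), since k <= NL/4, against a start of at most exp(- L/2): hence the
   exponent 1/4. *)
rewrite (_ : - (L / 4) = L / 4 - L / 2); last by lra.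
rewrite expRD expRN; apply: ler_pM; rewrite ?exprn_ge0 ?addr_ge0 ?invr_ge0 //.
- apply: le_trans (expr_1D_le _ _) _; first by rewrite addr_ge0 ?invr_ge0 // ltW.
  by rewrite ler_expR ler_pdivrMr //; nra.
- by rewrite lef_pV2 ?posrE ?expR_gt0 ?ltr0n.
Qed.

(** exp(L/4) >= 1 + L/4 >= 9/8 for L = ln n. It keeps [block_swap] unsorted with probability at
    least 1/9 in the bound on the mean. *)
Lemma powR_quarter_le (R : realType) (n : nat) : (2 <= n)%N ->
  n%:R `^ (- 4^-1) <= 8 / 9 :> R.
Proof.
move=> n2; rewrite powR_quarter; last exact: ltnW.
have L2 := half_le_ln R n2; have := expR_ge1Dx (ln n%:R / 4 : R).
rewrite expRN => e; rewrite -[8 / 9]invrK lef_pV2 ?posrE ?expR_gt0 //.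
by apply: le_trans e; lra.
Qed.

(** * Bounds on the mean, and the conclusion *)

Lemma mean_tau_le (R : realType) (n : nat) (d : Order.disp_t)
    (T : orderType d) (dO : measure_display) (Omega : measurableType dO)
    (P : probability Omega R) (S : nat -> Omega -> pos_pair n)
    (x : n.-tuple T) :
  (2 <= n)%N -> uniform_sorter P S ->
  (\int[P]_w tau R S x w <= (3 * n%:R ^+ 2 * ln n%:R)%:E)%E.
Proof.
move=> n2 US; rewrite (integral_tau x US).
have [K K_le] := mean_bound R n2; have [N1 _ _] := bin2_bounds R n2.
apply: lime_le; first by apply: is_cvg_nneseries => k _ _.
apply: nearW => m; apply: (@le_trans _ _ (\sum_(0 <= k < m)
  (if (k < K)%N then 1 else (1 - 'C(n, 2)%:R^-1) ^+ k * 'C(n, 2)%:R : R)%:E)%E).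
  apply: lee_sum => k _; case: ifP => _; last exact: run_prob_unsorted.
  apply: probability_le1.
  exact: (run_measurable x k (fun y => ~~ sorted <=%O y) US).
rewrite sumEFin lee_fin; apply: le_trans K_le.
exact: truncated_geometric_sum.
Qed.

Lemma mean_tau_block_swap_ge (R : realType) (n : nat)
    (dO : measure_display) (Omega : measurableType dO)
    (P : probability Omega R) (S : nat -> Omega -> pos_pair n) :
  (2 <= n)%N -> uniform_sorter P S ->
  ((144^-1 * n%:R ^+ 2 * ln n%:R)%:E <=
   \int[P]_w tau R S (block_swap n) w)%E.
Proof.
move=> n2 US; rewrite (integral_tau (block_swap n) US).
have T0 : 0 <= n%:R ^+ 2 * ln n%:R / 16 :> R.
  by rewrite divr_ge0 ?mulr_ge0 ?sqr_ge0 // ln_ge0 // ler1n ltnW.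
have /andP[KT TK] := truncn_itv T0; set K := Num.truncn _ in KT TK.
apply: le_trans (nneseries_lim_ge K.+1 _); last by move=> k _ _.
(* There are K + 1 > n^2 ln n / 16 times, each contributing at least 1/9: hence the constant
   1/144. *)
apply: (@le_trans _ _ (\sum_(0 <= k < K.+1) (9^-1 : R)%:E)%E).
  rewrite sumEFin sumr_const_nat subn0 lee_fin -mulr_natr; lra.
rewrite !big_nat; apply: lee_sum => k /andP[_ kK].
have -> : unsorted_at S (block_swap n) k =
    ~` [set w | sorted <=%O (run (fun i => S i w) (block_swap n) k)].
  by apply/seteqP; split=> w /negP.
rewrite probability_setC; last first.
  exact: (run_measurable _ k (fun y => sorted <=%O y) US).
apply: (@le_trans _ _ (1 - (8 / 9 : R)%:E)%E); first by rewrite lee_fin; lra.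
apply: leeB => //; apply: le_trans (run_prob_sorted_block_swap k n2 US) _.
rewrite lee_fin; apply: le_trans (powR_quarter_le R n2).
by apply: block_swap_bound => //; apply: le_trans KT; rewrite ler_nat.
Qed.

Theorem theorem1p3 (R : realType) :
  exists c C gamma : R, 0 < c /\ c < C /\ 0 < gamma /\
  forall n : nat, (2 <= n)%N ->
    (forall (d : Order.disp_t) (T : orderType d) (x : n.-tuple T)
        (dO : measure_display) (Omega : measurableType dO)
        (P : probability Omega R) (S : nat -> Omega -> pos_pair n),
      uniform_sorter P S ->
      (\int[P]_w tau R S x w <= (C * n%:R ^+ 2 * ln n%:R)%:E)%E /\
      (P [set w | ((C * n%:R ^+ 2 * ln n%:R)%:E < tau R S x w)%E]
         <= (C * n%:R `^ (- gamma))%:E)%E) /\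
    (exists (d : Order.disp_t) (T : orderType d) (x : n.-tuple T),
      forall (dO : measure_display) (Omega : measurableType dO)
        (P : probability Omega R) (S : nat -> Omega -> pos_pair n),
      uniform_sorter P S ->
      ((c * n%:R ^+ 2 * ln n%:R)%:E <= \int[P]_w tau R S x w)%E /\
      (P [set w | (tau R S x w < (c * n%:R ^+ 2 * ln n%:R)%:E)%E]
         <= (C * n%:R `^ (- gamma))%:E)%E).
Proof.
(* 1/144 and 3 come from the two bounds on the mean, 1/4 from the growth estimate for
   [block_swap]. *)
exists 144^-1, 3, 4^-1; split; first lra; split; first lra; split; first lra.
move=> n n2; have L0 : 0 <= ln n%:R :> R by rewrite ln_ge0 // ler1n ltnW.
have nL0 : 0 <= n%:R ^+ 2 * ln n%:R :> R by rewrite mulr_ge0 ?sqr_ge0.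
split=> [d T x dO Omega P S US|].
  split; first exact: mean_tau_le.
  have T0 : 0 <= 3 * n%:R ^+ 2 * ln n%:R :> R by lra.
  (* Rounding the threshold t down to k gives k <= t < k + 1: the first for the event inclusion, the
     second for the tail estimate. *)
  have /andP[KT TK] := truncn_itv T0.
  apply: le_trans (prob_tau_gt_le x US KT) _.
  apply: le_trans (run_prob_unsorted x _ n2 US) _.
  by rewrite lee_fin tail_bound // ltW.
exists _, nat, (block_swap n) => dO Omega P S US.
split; first exact: mean_tau_block_swap_ge.
have T0 : 0 <= 144^-1 * n%:R ^+ 2 * ln n%:R :> R by lra.
have /andP[KT TK] := truncn_itv T0.
apply: le_trans (prob_tau_lt_le (block_swap n) US (ltW TK)) _.
apply: le_trans (run_prob_sorted_block_swap _ n2 US) _.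
(* The threshold with 1/144 lies below the n^2 ln n / 16 that the estimate allows. *)
rewrite lee_fin; apply: le_trans (block_swap_bound n2 _) _; first by lra.
by rewrite ler_peMl ?powR_ge0 // ler1n.
Qed.
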